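(* Let $R$ be a non-associative ring, let $\delta : R \to R$ be a kernel derivation on $R$, and put $D = R[X; \mathrm{id}_R, \delta]$. Then the following assertions hold: (a) If $R$ is $\delta$-simple, then every non-zero ideal of $D$ is generated by a unique monic polynomial in $Z(D)$. (b) If $R$ is $\delta$-simple, then there is a monic $b \in R_{\delta}[X]$, unique up to addition of elements from $Z(R)_{\delta}$, such that $Z(D) = Z(R)_{\delta}[b]$. (c) $D$ is simple if and only if $R$ is $\delta$-simple and $Z(D)$ is a field. In that case $Z(D) = Z(R)_{\delta}$, and the polynomial $b$ of (b) equals $1$. (d) If $R$ is $\delta$-simple, $\delta$ is a derivation on $R$ and $\mathrm{char}(R) = 0$, then, with $b$ as in (b), either $b = 1$ or there is $c \in R_{\delta}$ such that $b = c + X$. In the latter case, $\delta = -\delta_c$. (e) If $R$ is $\delta$-simple, $\delta$ is a derivation on $R$ and $\mathrm{char}(R) = p > 0$, then, with $b$ as in (b), either $b = 1$ or there are $c \in R_{\delta}$, $n \in \mathbb{N}$ and $b_0, \ldots, b_n \in Z(R)_{\delta}$, with $b_n = 1$, such that $b = c + \sum_{i=0}^n b_i X^{p^i}$. In the latter case, $\sum_{i=0}^n b_i \delta^{p^i} = -\delta_c$.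
   Context: A non-associative ring is an additive abelian group with a (not necessarily associative) multiplication that is left and right distributive, and with a multiplicative identity $1 \neq 0$. Ideals are two-sided. A ring is simple if $\{0\}$ and the ring itself are its only ideals. For a non-associative ring $A$: $[r,s] = rs - sr$ and $(r,s,t) = (rs)t - r(st)$. The commuter is $C(A) = \{ r \in A \mid [r,s]=0 \text{ for all } s \in A\}$, the nucleus $N(A)$ is the set of $r\in A$ with $(r,s,t)=(s,r,t)=(s,t,r)=0$ for all $s,t\in A$, and the center is $Z(A) = C(A) \cap N(A)$. Let $\delta : R \to R$ be additive with $\delta(1)=0$. Put $R_{\delta} = \ker(\delta)$ and $Z(R)_{\delta} = Z(R) \cap \ker(\delta)$. The map $\delta$ is a kernel derivation if it is right $R_\delta$-linear (i.e. $\delta(ra) = \delta(r)a$ for all $r \in R$, $a \in R_\delta$) or left $R_\delta$-linear (i.e. $\delta(ar) = a\delta(r)$ for all $r\in R$, $a \in R_\delta$). It is a derivation if $\delta(rs) = r\delta(s)+\delta(r)s$ for all $r,s\in R$. For $c \in R$, $\delta_c : R \to R$ is the map $\delta_c(r) = cr - rc$. An ideal $I$ of $R$ is $\delta$-invariant if $\delta(I)\subseteq I$; $R$ is $\delta$-simple if $\{0\}$ and $R$ are its only $\delta$-invariant ideals. If $R$ is $\delta$-simple (and $\delta$ is a kernel derivation) then $Z(R)_\delta$ is a field, so $\mathrm{char}(R)$ is $0$ or a prime. $R[X;\mathrm{id}_R,\delta]$ is the set of formal polynomials $\sum_i r_i X^i$ ($r_i\in R$) with the usual addition and with multiplication the biadditive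 extension of $aX^m \cdot bX^n = \sum_{i=0}^m \binom{m}{i} a\,\delta^{m-i}(b) X^{i+n}$, for $a,b\in R$, $m,n\in\mathbb{N}=\{0,1,2,\ldots\}$. It is a non-associative ring containing $R$ (identify $r$ with $rX^0$). A non-zero polynomial is monic if its leading coefficient is $1$. $R_\delta[X]$ denotes the set of polynomials with all coefficients in $R_\delta$, and $Z(R)_\delta[b]$ denotes the set of polynomial expressions $\sum_i z_i b^i$ with $z_i \in Z(R)_\delta$. *)

(* Defs.v *)
From HB Require Import structures.
From mathcomp Require Import all_boot all_order all_algebra.
From mathcomp Require Import finmap boolp classical_sets.
From mathcomp.multinomials Require Import monalg.

Set Implicit Arguments.
Unset Strict Implicit.
Unset Printing Implicit Defensive.

Import GRing.Theory.

Local Open Scope ring_scope.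
Local Open Scope classical_set_scope.

HB.mixin Record Zmodule_isNonAssocRing R & GRing.Zmodule R := {
  na_one : R;
  na_mul : R -> R -> R;
  na_mul1r : left_id na_one na_mul;
  na_mulr1 : right_id na_one na_mul;
  na_mulDl : left_distributive na_mul +%R;
  na_mulDr : right_distributive na_mul +%R;
  na_oner_neq0 : na_one <> 0
}.

HB.structure Definition NonAssocRing :=
  {R of Zmodule_isNonAssocRing R & GRing.Zmodule R}.

Notation nonAssocRingType := NonAssocRing.type.

Declare Scope na_scope.
Delimit Scope na_scope with na.
Notation "1" := (@na_one _) : na_scope.
Notation "x ** y" := (na_mul x y) (at level 40, left associativity) : na_scope.
Local Open Scope na_scope.

Section NonAssocRings.
Variable A : nonAssocRingType.
Implicit Types (r s t x y : A) (I S : set A).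

Definition commutator r s : A := r ** s - s ** r.

Definition associator r s t : A := (r ** s) ** t - r ** (s ** t).

Definition commuter : set A := [set r | forall s, commutator r s = 0].

Definition nucleus : set A :=
  [set r | forall s t,
     [/\ associator r s t = 0, associator s r t = 0 & associator s t r = 0]].

Definition center : set A := commuter `&` nucleus.

Record ideal I : Prop := Ideal {
  ideal0 : I 0;
  idealB : forall x y, I x -> I y -> I (x - y);
  idealMl : forall r x, I x -> I (r ** x);
  idealMr : forall r x, I x -> I (x ** r)
}.

Definition simple_ring : Prop :=
  forall I, ideal I -> I = [set 0] \/ I = setT.

Definition ideal_generated x : set A :=
  [set y | forall I, ideal I -> I x -> I y].

(* [S] contains the identity of [A] and is a field for the operations of [A];
   0 <> 1 holds in [A]. *)
Record field_in S : Prop := FieldIn {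
  field_in1 : S 1;
  field_inB : forall x y, S x -> S y -> S (x - y);
  field_inM : forall x y, S x -> S y -> S (x ** y);
  field_inC : forall x y, S x -> S y -> x ** y = y ** x;
  field_inA : forall x y t, S x -> S y -> S t -> x ** (y ** t) = (x ** y) ** t;
  field_inV : forall x, S x -> x <> 0 -> exists2 y, S y & x ** y = 1
}.

(* The kernel of the unique unital ring map from the integers to [A] is
   generated by [p]; in particular [p = 0] means that no [n > 0] kills 1. *)
Definition has_char (p : nat) : Prop :=
  forall n : nat, (1%na *+ n = 0 :> A) <-> (p %| n)%N.

(* Powers are only used for central elements, where bracketing is
   irrelevant. *)
Definition na_exp x (n : nat) : A := iter n (na_mul x) 1.

Definition inner_der (c : A) : A -> A := fun r => c ** r - r ** c.

End NonAssocRings.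

Arguments commuter : clear implicits.
Arguments nucleus : clear implicits.
Arguments center : clear implicits.

Section KernelDerivations.
Variables (R : nonAssocRingType) (delta : R -> R).

Definition kernel : set R := [set r | delta r = 0].

Definition center_kernel : set R := center R `&` kernel.

Definition kernel_derivation : Prop :=
  (forall r a, kernel a -> delta (r ** a) = delta r ** a) \/
  (forall r a, kernel a -> delta (a ** r) = a ** delta r).

Definition derivation : Prop :=
  forall r s, delta (r ** s) = r ** delta s + delta r ** s.

Definition invariant (I : set R) : Prop := forall r, I r -> I (delta r).

Definition delta_simple : Prop :=
  forall I, ideal I -> invariant I -> I = [set 0] \/ I = setT.

End KernelDerivations.

(* The type R[X; id, delta]: [<< a *g m >>] is a X^m and [p@_m] is the
   coefficient of X^m in p.  The condition delta(1) = 0 makes X^0 a right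
   identity. *)
Definition ore (R : nonAssocRingType) (delta : {additive R -> R})
  (delta1 : delta 1 = 0) : Type := {malg R[nat]}.

Section OreRing.
Variables (R : nonAssocRingType) (delta : {additive R -> R}).
Hypothesis delta1 : delta 1 = 0.

Local Notation D := (ore delta1).

HB.instance Definition _ := GRing.Zmodule.copy D {malg R[nat]}.

Definition ore_mulXX (a : R) (m : nat) (b : R) (n : nat) : D :=
  \sum_(i < m.+1) << (a ** iter (m - i) delta b) *+ 'C(m, i) *g (i + n)%N >>.

Definition ore_mul (p q : D) : D :=
  \sum_(m <- msupp p) \sum_(n <- msupp q) ore_mulXX p@_m m q@_n n.

Lemma na_mul0r (x : R) : 0 ** x = 0.
Proof. by apply: (addIr (0 ** x)); rewrite -na_mulDl !add0r. Qed.

Lemma na_mulr0 (x : R) : x ** 0 = 0.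
Proof. by apply: (addIr (x ** 0)); rewrite -na_mulDr !add0r. Qed.

Lemma iter_deltaD k : {morph iter k delta : x y / x + y}.
Proof. by elim: k => [//|k IH] x y /=; rewrite IH raddfD. Qed.

Lemma iter_delta0 k : iter k delta 0 = 0.
Proof. by elim: k => [//|k IH] /=; rewrite IH raddf0. Qed.

Lemma iter_delta1 k : (0 < k)%N -> iter k delta 1 = 0.
Proof. by case: k => // k _; rewrite iterSr delta1 iter_delta0. Qed.

Lemma ore_mulXXDl a a' m b n :
  ore_mulXX (a + a') m b n = ore_mulXX a m b n + ore_mulXX a' m b n.
Proof.
rewrite /ore_mulXX -big_split; apply: eq_bigr => i _ /=.
by rewrite na_mulDl mulrnDl monalgUD.
Qed.

Lemma ore_mulXXDr a m b b' n :
  ore_mulXX a m (b + b') n = ore_mulXX a m b n + ore_mulXX a m b' n.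
Proof.
rewrite /ore_mulXX -big_split; apply: eq_bigr => i _ /=.
by rewrite iter_deltaD na_mulDr mulrnDl monalgUD.
Qed.

Lemma ore_mulXX0l m b n : ore_mulXX 0 m b n = 0.
Proof. by apply: (addIr (ore_mulXX 0 m b n)); rewrite -ore_mulXXDl !add0r. Qed.

Lemma ore_mulXX0r a m n : ore_mulXX a m 0 n = 0.
Proof. by apply: (addIr (ore_mulXX a m 0 n)); rewrite -ore_mulXXDr !add0r. Qed.

Lemma sum_msuppw (V : zmodType) (p : {malg R[nat]}) (E : {fset nat})
    (F : nat -> V) :
    (msupp p `<=` E)%fset -> (forall k, p@_k = 0 -> F k = 0) ->
  \sum_(k <- msupp p) F k = \sum_(k <- E) F k.
Proof.
move=> pE F0; apply: big_fset_incl => // k _ kp.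
by apply: F0; apply: mcoeff_outdom.
Qed.

Lemma ore_mulEw (P Q : {fset nat}) (p q : D) :
    (msupp p `<=` P)%fset -> (msupp q `<=` Q)%fset ->
  ore_mul p q = \sum_(m <- P) \sum_(n <- Q) ore_mulXX p@_m m q@_n n.
Proof.
move=> pP qQ; rewrite /ore_mul (sum_msuppw pP) => [|k pk0]; last first.
  by rewrite big1 // => n _; rewrite pk0 ore_mulXX0l.
apply: eq_bigr => m _; rewrite (sum_msuppw qQ) // => k qk0.
by rewrite qk0 ore_mulXX0r.
Qed.

Lemma ore_mulDl : left_distributive ore_mul +%R.
Proof.
move=> p p' q; set P := (msupp p `|` msupp p')%fset.
have lP : (msupp p `<=` P)%fset by apply: fsubsetUl.
have rP : (msupp p' `<=` P)%fset by apply: fsubsetUr.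
rewrite (ore_mulEw (msuppD_le p p') (fsubset_refl (msupp q))).
rewrite (ore_mulEw lP (fsubset_refl _)) (ore_mulEw rP (fsubset_refl _)).
rewrite -big_split; apply: eq_bigr => m _; rewrite -big_split.
by apply: eq_bigr => n _ /=; rewrite mcoeffD ore_mulXXDl.
Qed.

Lemma ore_mulDr : right_distributive ore_mul +%R.
Proof.
move=> p q q'; set Q := (msupp q `|` msupp q')%fset.
have lQ : (msupp q `<=` Q)%fset by apply: fsubsetUl.
have rQ : (msupp q' `<=` Q)%fset by apply: fsubsetUr.
rewrite (ore_mulEw (fsubset_refl (msupp p)) (msuppD_le q q')).
rewrite (ore_mulEw (fsubset_refl _) lQ) (ore_mulEw (fsubset_refl _) rQ).
rewrite -big_split; apply: eq_bigr => m _; rewrite -big_split.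
by apply: eq_bigr => n _ /=; rewrite mcoeffD ore_mulXXDr.
Qed.

Lemma ore_mulUU (a b : R) (m n : nat) :
  ore_mul << a *g m >> << b *g n >> = ore_mulXX a m b n.
Proof.
rewrite (ore_mulEw (@msuppU_le _ _ m a) (@msuppU_le _ _ n b)).
by rewrite !big_seq_fset1 !mcoeffUU.
Qed.

Definition ore_monom (a : R) (m : nat) : D := << a *g m >>.

Definition ore_const (r : R) : D := ore_monom r 0.

Lemma ore_mul1r : left_id (ore_const 1) ore_mul.
Proof.
move=> p; rewrite (ore_mulEw (@msuppU_le _ _ 0%N (na_one : R)) (fsubset_refl _)).
rewrite big_seq_fset1 mcoeffUU [RHS](monalgEw (fsubset_refl _)).
apply: eq_bigr => n _.
by rewrite /ore_mulXX big_ord1 /= na_mul1r mulr1n.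
Qed.

Lemma ore_mulr1 : right_id (ore_const 1) ore_mul.
Proof.
move=> p; rewrite (ore_mulEw (fsubset_refl _) (@msuppU_le _ _ 0%N (na_one : R))).
rewrite [RHS](monalgEw (fsubset_refl _)); apply: eq_bigr => m _.
rewrite big_seq_fset1 mcoeffUU /ore_mulXX big_ord_recr /= big1 => [|i _].
  by rewrite subnn /= na_mulr1 binn mulr1n addn0 add0r.
by rewrite iter_delta1 ?subn_gt0 // na_mulr0 mul0rn monalgU0.
Qed.

Lemma ore_oner_neq0 : ore_const 1 <> 0.
Proof.
by move/(congr1 (mcoeff 0%N)); rewrite mcoeffUU mcoeff0; apply: na_oner_neq0.
Qed.

HB.instance Definition _ := Zmodule_isNonAssocRing.Build D
  ore_mul1r ore_mulr1 ore_mulDl ore_mulDr ore_oner_neq0.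

Definition ore_deg (p : D) : nat := \max_(i <- msupp p) i.

Definition ore_lead_coef (p : D) : R := p@_(ore_deg p).

Definition ore_monic (p : D) : Prop := p <> 0 /\ ore_lead_coef p = 1.

Definition ore_over (S : set R) : set D := [set p | forall i, S p@_i].

Definition poly_exprs (S : set R) (b : D) : set D :=
  [set p | exists (n : nat) (z : nat -> R), (forall i, (i < n)%N -> S (z i)) /\
     p = \sum_(i < n) ore_const (z i) ** na_exp b i].

Definition center_generator (b : D) : Prop :=
  [/\ ore_monic b, ore_over (kernel delta) b &
      center D = poly_exprs (center_kernel delta) b].

End OreRing.

(* Main.v *)
Require Import Defs.
From HB Require Import structures.
From mathcomp Require Import all_boot all_order all_algebra.
From mathcomp Require Import finmap boolp classical_sets.
From mathcomp.multinomials Require Import monalg.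

Local Open Scope classical_set_scope.
Local Open Scope na_scope.
Local Open Scope ring_scope.

Set Implicit Arguments.
Unset Strict Implicit.
Import GRing.Theory.

(** Write [D] for the ring of polynomials, [Z] for its center and [F] for the
    central elements of [R] in the kernel of [delta].

    The powers of [X] lie in the right and in the middle nucleus of [D]
    ([mulA_Xn], [mul_XnA]). So an element [f] is central as soon as its
    coefficients lie in the kernel of [delta], which says that it commutes with
    [X], it commutes with the constants, and the associators [(f, a, c)] and
    [(a, f, c)] vanish for constants [a] and [c] ([const_central_center]). The
    hypothesis that [delta] is a kernel derivation enters through
    [(X, f, c) = 0] ([const_central_XA]). None of the operations in this
    criterion raises the degree, which is what makes arguments on minimal degree
    work.

    Ideals: the leading coefficients of the elements of minimal degree in a
    nonzero ideal of [D] form a delta-invariant ideal of [R], so the ideal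
    contains a monic [f] of minimal degree ([min_monic]). Commutators and
    associators of [f] with constants lie in the ideal and have smaller degree:
    they vanish and [f] is central ([min_monic_center]). Division by [f] shows
    that it generates the ideal.

    Center: let [b] be a monic non-constant central element of least degree, or
    1 if there is none. When a central element is divided by [b], quotient and
    remainder are central ([divide_center]); the remainder is a constant by
    minimality, and iterating on the quotient gives a polynomial expression in
    [b] with coefficients in [F] ([min_center_exprs]).

    Simplicity: in a simple ring every nonzero central element is invertible,
    whereas a monic polynomial of positive degree never is; conversely a central
    generator of an ideal that is invertible generates [D].

    Shape of [b]: the Hasse derivatives of [D] commute with left and right
    multiplications by constants, so by the criterion they preserve [Z]
    ([hasse_center]). Those of [b] have smaller degree than [b], hence are
    constants: [b_k] lies in [F] for [k > 0], and ['C(m, k) b_m = 0] for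
    [0 < k < m] ([center_generator_hasse]). A delta-simple ring has no torsion
    other than its characteristic, so in characteristic 0 the degree is at most
    1, and in characteristic [p] only the exponents 0 and [p^i] occur, because
    any other [m] has some ['C(m, k)] prime to [p] ([bin_not_dvd]). The
    coefficient of [X^0] in [b r = r b] is the identity satisfied by
    [delta]. *)

(** * Binomial coefficients modulo a prime *)

(** Compare the coefficients of [X^q] in
    [(X + 1)^(q u) = (X^q + 1)^u] over the field with [p] elements, for
    [q = p^v]. *)
Lemma bin_ppow_mod p v u : prime p -> (0 < u)%N ->
  'C(p ^ v * u, p ^ v) = u %[mod p].
Proof.
move=> pp u0; set q := (p ^ v)%N.
have q0 : (0 < q)%N by rewrite expn_gt0 prime_gt0.
have chF : p \in [pchar {poly 'F_p}] by rewrite pchar_poly pchar_Fp.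
have E : ('X + 1 : {poly 'F_p}) ^+ (q * u) = ('X^q + 1) ^+ u.
  by rewrite exprM exprDn_pchar ?expr1n // pnatX (pnatE _ pp) chF.
move: (congr1 (fun f : {poly 'F_p} => f`_q) E); rewrite !exprD1n !poly.coef_sum.
have lq : (q < (q * u).+1)%N by rewrite ltnS leq_pmulr.
have l1 : (1 < u.+1)%N by [].
rewrite (bigD1 (Ordinal lq)) //= big1 ?addr0 => [|i iq]; last first.
  rewrite coefMn coefXn; case: eqP => [e|_]; last by rewrite mul0rn.
  by case/eqP: iq; apply: val_inj.
rewrite (bigD1 (Ordinal l1)) //= big1 ?addr0 => [|i i1]; last first.
  rewrite coefMn -exprM coefXn -{1}[q]muln1 eqn_pmul2l //.
  case: eqP => [e|_]; last by rewrite mul0rn.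
  by case/eqP: i1; apply: val_inj.
rewrite expr1 bin1 !coefMn !coefXn eqxx => /(congr1 val).
by rewrite /= !val_Fp_nat.
Qed.

(** The [p]-part of [m] is such a [k]. *)
Lemma bin_not_dvd p m : prime p -> (0 < m)%N -> (forall i, m <> (p ^ i)%N) ->
  exists k, [/\ (0 < k)%N, (k < m)%N & ~~ (p %| 'C(m, k))%N].
Proof.
move=> pp m0 Np; have [u Npu mE] := pfactor_coprime pp m0.
have u0 : (0 < u)%N by case: u Npu mE m0 => // _ ->.
have u1 : (1 < u)%N.
  rewrite ltn_neqAle u0 andbT eq_sym; apply/eqP => u1.
  by apply: (Np (logn p m)); rewrite {1}mE u1 mul1n.
have q0 : (0 < p ^ logn p m)%N by rewrite expn_gt0 prime_gt0.
exists (p ^ logn p m)%N; split=> //.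
  by rewrite {2}mE -{1}[(p ^ _)%N]mul1n ltn_pmul2r.
rewrite {1}mE mulnC /dvdn bin_ppow_mod // -/(dvdn p u).
by rewrite -prime_coprime.
Qed.

(** * Central elements and ideals of non-associative rings *)

Section NonAssociativeRings.
Variable A : nonAssocRingType.
Implicit Types (x y s t : A) (I : set A).

Lemma na_mulNl x y : (- x) ** y = - (x ** y).
Proof. by apply: (addIr (x ** y)); rewrite -na_mulDl !addNr na_mul0r. Qed.

Lemma na_mulNr x y : x ** (- y) = - (x ** y).
Proof. by apply: (addIr (x ** y)); rewrite -na_mulDr !addNr na_mulr0. Qed.

Lemma na_mulBl x y t : (x - y) ** t = x ** t - y ** t.
Proof. by rewrite na_mulDl na_mulNl. Qed.

Lemma na_mulBr t x y : t ** (x - y) = t ** x - t ** y.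
Proof. by rewrite na_mulDr na_mulNr. Qed.

Lemma na_mulMnl x y n : (x *+ n) ** y = (x ** y) *+ n.
Proof.
by elim: n => [|n IH]; rewrite ?mulr0n ?na_mul0r // !mulrS na_mulDl IH.
Qed.

Lemma na_mulMnr x y n : x ** (y *+ n) = (x ** y) *+ n.
Proof.
by elim: n => [|n IH]; rewrite ?mulr0n ?na_mulr0 // !mulrS na_mulDr IH.
Qed.

Lemma na_mul_sumr (T : Type) (r : seq T) (F : T -> A) x :
  x ** (\sum_(i <- r) F i) = \sum_(i <- r) x ** F i.
Proof. by apply: (big_morph _ (na_mulDr x) (na_mulr0 x)). Qed.

Lemma na_mul_suml (T : Type) (r : seq T) (F : T -> A) x :
  (\sum_(i <- r) F i) ** x = \sum_(i <- r) F i ** x.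
Proof.
by apply: (big_morph (fun y => y ** x) _ (na_mul0r x)) => y t; rewrite na_mulDl.
Qed.

Lemma center_comm x s : center A x -> x ** s = s ** x.
Proof. by case=> + _ => /(_ s) /subr0_eq. Qed.

Lemma center_mulAl x s t : center A x -> (x ** s) ** t = x ** (s ** t).
Proof. by case=> _ /(_ s t) [/subr0_eq]. Qed.

Lemma center_mulAm x s t : center A x -> (s ** x) ** t = s ** (x ** t).
Proof. by case=> _ /(_ s t) [_ /subr0_eq]. Qed.

Lemma center_mulAr x s t : center A x -> (s ** t) ** x = s ** (t ** x).
Proof. by case=> _ /(_ s t) [_ _ /subr0_eq]. Qed.

(** For an element that commutes with everything, the third associator
    condition follows from the other two:
    [(s t) x = x (s t) = (x s) t = (s x) t = s (x t) = s (t x)]. *)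
Lemma centerI x : (forall s, x ** s = s ** x) ->
    (forall s t, (x ** s) ** t = x ** (s ** t)) ->
    (forall s t, (s ** x) ** t = s ** (x ** t)) -> center A x.
Proof.
move=> xC xAl xAm; split=> [s|s t]; first by apply/eqP; rewrite subr_eq0 xC.
split; apply/eqP; rewrite subr_eq0 ?xAl ?xAm //.
by rewrite -xC -xAl xC xAm xC.
Qed.

Lemma center1 : center A na_one.
Proof. by apply: centerI => *; rewrite !na_mul1r ?na_mulr1. Qed.

Lemma center0 : center A 0.
Proof. by apply: centerI => *; rewrite !(na_mul0r, na_mulr0). Qed.

Lemma centerB x y : center A x -> center A y -> center A (x - y).
Proof.
move=> Zx Zy; apply: centerI => *; rewrite !(na_mulBl, na_mulBr).
- by rewrite !(center_comm _ Zx, center_comm _ Zy).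
- by rewrite (center_mulAl _ _ Zx) (center_mulAl _ _ Zy).
- by rewrite (center_mulAm _ _ Zx) (center_mulAm _ _ Zy).
Qed.

Lemma centerD x y : center A x -> center A y -> center A (x + y).
Proof.
move=> Zx Zy; rewrite -[y]opprK; apply: centerB => //.
by rewrite -[- y]add0r; apply: centerB => //; apply: center0.
Qed.

Lemma centerM x y : center A x -> center A y -> center A (x ** y).
Proof.
move=> Zx Zy; apply: centerI => [s|s t|s t].
- rewrite (center_mulAl _ _ Zx) (center_comm _ Zy) -(center_mulAl _ _ Zx).
  by rewrite (center_comm _ Zx) (center_mulAm _ _ Zx).
- by rewrite !(center_mulAl _ _ Zx) !(center_mulAl _ _ Zy).
- rewrite (center_mulAl _ _ Zx) -(center_mulAm _ _ Zx) (center_mulAm _ _ Zy).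
  by rewrite (center_mulAm _ _ Zx).
Qed.

(** A central [x] with a right inverse can be cancelled on the left, and each
    centrality condition on the inverse holds after multiplication by [x]. *)
Lemma center_inv x y : center A x -> x ** y = na_one -> center A y.
Proof.
move=> Zx xy1.
have xI s t : x ** s = x ** t -> s = t.
  suff yxK u : y ** (x ** u) = u by move=> /(congr1 (na_mul y)); rewrite !yxK.
  by rewrite -(center_mulAm _ _ Zx) -(center_comm _ Zx) xy1 na_mul1r.
have xyK s : x ** (y ** s) = s by rewrite -(center_mulAl _ _ Zx) xy1 na_mul1r.
have xKy s : x ** (s ** y) = s.
  by rewrite -(center_mulAl _ _ Zx) (center_comm _ Zx) (center_mulAm _ _ Zx)
     xy1 na_mulr1.
apply: centerI => [s|s t|s t]; apply: xI; rewrite ?xyK ?xKy //.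
  by rewrite -(center_mulAl _ _ Zx) xyK.
rewrite -(center_mulAl _ _ Zx) xKy -(center_mulAl _ _ Zx) (center_comm _ Zx).
by rewrite (center_mulAm _ _ Zx) xyK.
Qed.

Lemma principal_ideal x : center A x -> ideal [set x ** s | s in setT].
Proof.
move=> Zx; split=> [|_ _ [s _ <-] [t _ <-]|r _ [s _ <-]|r _ [s _ <-]].
- by exists 0; rewrite ?na_mulr0.
- by exists (s - t); rewrite ?na_mulBr.
- by exists (r ** s); rewrite // -(center_mulAl _ _ Zx) (center_comm _ Zx)
     (center_mulAm _ _ Zx).
- by exists (s ** r); rewrite // (center_mulAl _ _ Zx).
Qed.

Lemma ideal_generated_center x :
  center A x -> ideal_generated x = [set x ** s | s in setT].
Proof.
move=> Zx; apply/seteqP; split=> [y|_ [s _ <-] I iI Ix]; last exact: Defs.idealMr.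
apply; first exact: principal_ideal.
by exists na_one; rewrite ?na_mulr1.
Qed.

Lemma ideal_setT I : ideal I -> I na_one -> I = setT.
Proof.
move=> iI I1; apply/seteqP; split=> // x _; rewrite -[x]na_mulr1.
exact: Defs.idealMl.
Qed.

Lemma idealD I x y : ideal I -> I x -> I y -> I (x + y).
Proof.
move=> iI Ix Iy; rewrite -[y]opprK -[- y]add0r; apply: idealB => //.
by apply: idealB => //; apply: ideal0.
Qed.

End NonAssociativeRings.

(** * Coefficients of products in the differential polynomial ring *)

Section DifferentialPolynomials.
Variables (R : nonAssocRingType) (delta : {additive R -> R}).
Hypothesis delta1 : delta na_one = 0.

Local Notation D := (ore delta1).
(** Monomials are only handled through their coefficients; unification must not
    unfold them to finitely supported functions. *)
Definition monom : R -> nat -> D := locked (ore_monom delta1).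

Local Notation C a := (monom a 0).
Local Notation X := (monom na_one 1).
Local Notation Z := (center D).

Implicit Types (p q f g b : D) (a c r : R) (i j k m n d : nat).

Lemma coef0 k : (0 : D)@_k = 0.
Proof. exact: mcoeff0. Qed.

Lemma coefD p q k : (p + q)@_k = p@_k + q@_k.
Proof. exact: mcoeffD. Qed.

Lemma coefN p k : (- p)@_k = - p@_k.
Proof. exact: mcoeffN. Qed.

Lemma coefB p q k : (p - q)@_k = p@_k - q@_k.
Proof. exact: mcoeffB. Qed.

Lemma coef_sum (T : Type) (r : seq T) (F : T -> D) k :
  (\sum_(i <- r) F i)@_k = \sum_(i <- r) (F i)@_k.
Proof.
by apply: (big_morph (fun p : D => p@_k)) => [p q|]; rewrite ?coefD ?coef0.
Qed.

Lemma monomE a m : ore_monom delta1 a m = monom a m.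
Proof. by rewrite /monom -lock. Qed.

Lemma coef_monom a m k : (monom a m)@_k = a *+ (m == k).
Proof. by rewrite -monomE; apply: mcoeffU. Qed.

Lemma constE a : ore_const delta1 a = C a.
Proof. exact: monomE. Qed.

Lemma const1 : C na_one = na_one.
Proof. by rewrite -monomE. Qed.

Lemma coefC a k : (C a)@_k = a *+ (k == 0%N).
Proof. by rewrite coef_monom eq_sym. Qed.

Lemma coefP p q : (forall k, p@_k = q@_k) -> p = q.
Proof. by move/malgP. Qed.

(** Recording only an upper bound for the degree avoids a convention for the
    degree of 0. *)
Definition deg_lt p n := forall k, (n <= k)%N -> p@_k = 0.

Lemma deg_lt_ore_deg p : deg_lt p (ore_deg p).+1.
Proof.
move=> k ltk; apply: mcoeff_outdom; apply: contraL ltk => kp.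
rewrite -leqNgt /ore_deg.
exact: (@leq_bigmax_seq _ (enum_fset (msupp p)) xpredT id k kp isT).
Qed.

Lemma deg_ltW p m n : (m <= n)%N -> deg_lt p m -> deg_lt p n.
Proof. by move=> mn pm k nk; apply: pm; apply: leq_trans nk. Qed.

Lemma deg_lt0 p : deg_lt p 0 -> p = 0.
Proof. by move=> p0; apply: coefP => k; rewrite p0 ?coef0. Qed.

Lemma deg_lt_zero n : deg_lt 0 n.
Proof. by move=> k _; rewrite coef0. Qed.

Lemma deg_lt1 p : deg_lt p 1 -> p = C p@_0.
Proof.
move=> p1; apply: coefP => -[|k]; rewrite coefC ?mulr1n //.
by rewrite p1.
Qed.

Lemma deg_ltC a : deg_lt (C a) 1.
Proof. by case=> // k _; rewrite coefC. Qed.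

Lemma deg_ltS p n : deg_lt p n.+1 -> p@_n = 0 -> deg_lt p n.
Proof.
by move=> pn p0 k; rewrite leq_eqVlt => /orP[/eqP <- //|]; apply: pn.
Qed.

Lemma deg_ltB p q n : deg_lt p n -> deg_lt q n -> deg_lt (p - q) n.
Proof. by move=> pn qn k nk; rewrite coefB pn ?qn ?subrr. Qed.

Lemma deg_ltD p q n : deg_lt p n -> deg_lt q n -> deg_lt (p + q) n.
Proof. by move=> pn qn k nk; rewrite coefD pn ?qn ?addr0. Qed.

Lemma deg_lt_exact p : p <> 0 -> exists2 n, p@_n <> 0 & deg_lt p n.+1.
Proof.
move=> p0; have := @deg_lt_ore_deg p.
elim: (ore_deg p).+1 => [/deg_lt0 //|n IH pn].
by case: (pselect (p@_n = 0)) => [/(deg_ltS pn)|]; [exact: IH|exists n].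
Qed.

Lemma ore_deg_eq p n : p@_n <> 0 -> deg_lt p n.+1 -> ore_deg p = n.
Proof.
move=> pn0 pn; apply/eqP; rewrite eqn_leq; apply/andP; split; last first.
  apply: contra_notT pn0; rewrite -ltnNge; exact: deg_lt_ore_deg.
apply/bigmax_leqP_seq => k kp _; rewrite -ltnS ltnNge; apply/negP => /pn.
by apply/eqP; rewrite mcoeff_neq0.
Qed.

Lemma ore_monicP p :
  ore_monic p <-> exists2 n, p@_n = na_one & deg_lt p n.+1.
Proof.
split=> [[_ p1]|[n pn1 pn]].
  by exists (ore_deg p) => //; apply: deg_lt_ore_deg.
have pn0 : p@_n <> 0 by rewrite pn1; apply: na_oner_neq0.
split=> [p0|]; first by apply: pn0; rewrite p0 coef0.
by rewrite /ore_lead_coef (ore_deg_eq pn0).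
Qed.

Lemma ore_sumE p n : deg_lt p n -> p = \sum_(k < n) monom p@_(k : nat) k.
Proof.
move=> pn; apply: coefP => j; rewrite coef_sum.
have [jn|nj] := ltnP j n.
  rewrite (bigD1 (Ordinal jn)) //= big1 => [|i ij].
    by rewrite coef_monom eqxx addr0.
  by rewrite coef_monom; case: eqP => // e; case/eqP: ij; apply: val_inj.
rewrite pn // big1 // => i _; rewrite coef_monom; case: eqP => // e.
by move: nj; rewrite -e leqNgt ltn_ord.
Qed.

(** Monomials generate [D] additively, so identities between additive maps
    can be checked on them. *)
Lemma ore_additive_ext (V : zmodType) (F G : D -> V) :
    {morph F : p q / p + q} -> {morph G : p q / p + q} ->
    (forall a m, F (monom a m) = G (monom a m)) ->
  forall p, F p = G p.
Proof.
have H0 (H : D -> V) : {morph H : p q / p + q} -> H 0 = 0.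
  by move=> HD; apply: (addIr (H 0)); rewrite -HD !add0r.
move=> FD GD FG p; rewrite (ore_sumE (@deg_lt_ore_deg p)).
rewrite (big_morph _ FD (H0 _ FD)) (big_morph _ GD (H0 _ GD)).
by apply: eq_bigr.
Qed.

Lemma monom0 m : monom 0 m = 0.
Proof. by apply: coefP => k; rewrite coef0 coef_monom mul0rn. Qed.

Lemma mul_monom a m c n : monom a m ** monom c n =
  \sum_(i < m.+1) monom ((a ** iter (m - i) delta c) *+ 'C(m, i)) (i + n).
Proof.
rewrite -!monomE [LHS]ore_mulUU; apply: eq_bigr => i _.
by rewrite -monomE.
Qed.

Lemma mul_const_monom a c n : C a ** monom c n = monom (a ** c) n.
Proof. by rewrite mul_monom big_ord1 /= mulr1n. Qed.

Lemma constM a c : C (a ** c) = C a ** C c.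
Proof. by rewrite mul_const_monom. Qed.

Lemma coef_constM a q k : (C a ** q)@_k = a ** q@_k.
Proof.
apply: (@ore_additive_ext _ (fun q => (C a ** q)@_k)
  (fun q => a ** q@_k)) => [p r|p r|c m].
- by rewrite na_mulDr coefD.
- by rewrite coefD na_mulDr.
- by rewrite mul_const_monom !coef_monom na_mulMnr.
Qed.

Lemma coef_XM q k :
  (X ** q)@_k = delta q@_k + (if k is j.+1 then q@_j else 0).
Proof.
apply: (@ore_additive_ext _ (fun q => (X ** q)@_k)
  (fun q => delta q@_k + (if k is j.+1 then q@_j else 0))) => [p r|p r|c m].
- by rewrite na_mulDr coefD.
- by case: k => [|k]; rewrite !coefD raddfD ?addr0 // addrACA.
rewrite mul_monom big_ord_recr big_ord1 /= !na_mul1r !mulr1n add0n.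
rewrite coefD !coef_monom raddfMn add1n; congr (_ + _).
by case: k => [|k]; rewrite ?coef_monom.
Qed.

Lemma mul_monomXn a m n : monom a m ** monom na_one n = monom a (m + n).
Proof.
rewrite mul_monom big_ord_recr /= big1 => [|i _].
  by rewrite subnn /= na_mulr1 binn mulr1n add0r.
by rewrite (iter_delta1 delta1) ?subn_gt0 // na_mulr0 mul0rn monom0.
Qed.

Lemma coef_mulXn q n k :
  (q ** monom na_one n)@_k = if (n <= k)%N then q@_(k - n)%N else 0.
Proof.
apply: (@ore_additive_ext _ (fun q => (q ** monom na_one n)@_k)
  (fun q => if (n <= k)%N then q@_(k - n)%N else 0)) => [p r|p r|c m].
- by rewrite na_mulDl coefD.
- by case: leqP; rewrite ?coefD ?addr0.
rewrite mul_monomXn coef_monom; case: leqP => [nk|kn].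
  by rewrite coef_monom -{1}(subnK nk) eqn_add2r.
by case: eqP => // e; move: kn; rewrite -e ltnNge leq_addl.
Qed.

Lemma iter_XMD m : {morph iter m (na_mul X) : p q / p + q}.
Proof. by elim: m => // m IH p q /=; rewrite IH na_mulDr. Qed.

Lemma coef_iterXM_monom m c n k :
  (iter m (na_mul X) (monom c n))@_k =
    if (n <= k)%N then iter (m - (k - n)) delta c *+ 'C(m, k - n) else 0.
Proof.
elim: m k => [|m IH] k.
  rewrite /= coef_monom eqn_leq; case: (leqP n k) => //= nk.
  by rewrite bin0n subn_eq0.
rewrite iterS coef_XM IH; have [nk|kn] := leqP n k; last first.
  rewrite raddf0 add0r; case: k kn => // k kn.
  by rewrite IH leqNgt (ltn_trans _ kn).
case: k nk => [|k] nk.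
  by move: nk; rewrite leqn0 => /eqP ->; rewrite !bin0 !subn0 !mulr1n addr0.
rewrite IH raddfMn; move: nk; rewrite leq_eqVlt => /orP[/eqP ->|nk].
  by rewrite ltnn subnn !bin0 !subn0 !mulr1n addr0.
rewrite -ltnS nk subSn // subSS binS mulrnDr; congr (_ + _).
have [lt|ge] := ltnP (k - n) m; last by rewrite bin_small // !mulr0n.
by rewrite -iterS -subSn // subSS.
Qed.

(** The binomial formula that defines the product is the iteration of
    [X (c X^n) = delta c X^n + c X^(n+1)]. With this form of the product,
    associativity statements about [X] become statements on iterates. *)
Lemma mul_monomE a m q : monom a m ** q = C a ** iter m (na_mul X) q.
Proof.
apply: (@ore_additive_ext _ (fun q => monom a m ** q)
  (fun q => C a ** iter m (na_mul X) q)) => [p r|p r|c n].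
- by rewrite na_mulDr.
- by rewrite iter_XMD na_mulDr.
apply: coefP => k; rewrite coef_constM coef_iterXM_monom.
rewrite mul_monom coef_sum.
case: leqP => [nk|kn]; last first.
  rewrite na_mulr0 big1 // => i _; rewrite coef_monom.
  by case: eqP => // e; move: kn; rewrite -e ltnNge leq_addl.
have E (i : 'I_m.+1) : (i + n == k)%N = (val i == k - n)%N.
  by rewrite -{1}(subnK nk) eqn_add2r.
have [ltk|] := ltnP (k - n) m.+1; last first.
  move=> ge; rewrite bin_small // mulr0n na_mulr0 big1 // => i _.
  rewrite coef_monom (E i); case: eqP => // e.
  by move: ge; rewrite -e leqNgt ltn_ord.
rewrite (bigD1 (Ordinal ltk)) //= big1 => [|i ik]; rewrite coef_monom.
  by rewrite (E (Ordinal ltk)) eqxx mulr1n addr0 na_mulMnr.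
by rewrite (E i); case: eqP => // e; case/eqP: ik; apply: val_inj.
Qed.

Lemma mul_XnE m q : monom na_one m ** q = iter m (na_mul X) q.
Proof. by rewrite mul_monomE const1 na_mul1r. Qed.

Lemma mul_XnS m q : monom na_one m.+1 ** q = X ** (monom na_one m ** q).
Proof. by rewrite !mul_XnE. Qed.

Lemma monom_const_Xn a m : monom a m = C a ** monom na_one m.
Proof. by rewrite mul_const_monom na_mulr1. Qed.

Lemma mul_monomA a m q : monom a m ** q = C a ** (monom na_one m ** q).
Proof. by rewrite mul_monomE mul_XnE. Qed.

Lemma const_mulA_Xn a q n :
  (C a ** q) ** monom na_one n = C a ** (q ** monom na_one n).
Proof.
apply: coefP => k; rewrite coef_constM !coef_mulXn coef_constM.
by case: leqP => //; rewrite na_mulr0.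
Qed.

Lemma X_mulA_Xn q n : (X ** q) ** monom na_one n = X ** (q ** monom na_one n).
Proof.
apply: coefP => k; rewrite coef_XM !coef_mulXn coef_XM.
case: leqP => [nk|kn]; last first.
  rewrite raddf0 add0r; case: k kn => // k kn.
  by rewrite coef_mulXn leqNgt (ltn_trans _ kn).
congr (_ + _); case: k nk => [|k]; first by rewrite leqn0 => /eqP ->.
rewrite leq_eqVlt => /orP[/eqP ->|nk].
  by rewrite subnn coef_mulXn ltnn.
by rewrite coef_mulXn -ltnS nk subSn.
Qed.

(** Multiplying by [X^n] on the right shifts coefficients because
    [delta na_one = 0], so it commutes with every left multiplication. *)
Lemma mulA_Xn p q n : (p ** q) ** monom na_one n = p ** (q ** monom na_one n).
Proof.
apply: (@ore_additive_ext _ (fun p => (p ** q) ** monom na_one n)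
  (fun p => p ** (q ** monom na_one n))) => [u v|u v|a m].
- by rewrite !na_mulDl.
- by rewrite na_mulDl.
have E : (monom na_one m ** q) ** monom na_one n
         = monom na_one m ** (q ** monom na_one n).
  by rewrite 2!mul_XnE; elim: m => /= [//|m IH]; rewrite X_mulA_Xn IH.
by rewrite (mul_monomA a m q) const_mulA_Xn E -mul_monomA.
Qed.

Lemma mul_XA p q : (p ** X) ** q = p ** (X ** q).
Proof.
apply: (@ore_additive_ext _ (fun p => (p ** X) ** q)
  (fun p => p ** (X ** q))) => [u v|u v|a m].
- by rewrite !na_mulDl.
- by rewrite na_mulDl.
by rewrite mul_monomXn (mul_monomE _ _ q) (mul_monomE a m) addn1 iterSr.
Qed.

(** ** Degrees and leading coefficients *)

Lemma coefM p q n k : deg_lt p n ->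
  (p ** q)@_k = \sum_(i < n) p@_(i : nat) ** (iter i (na_mul X) q)@_k.
Proof.
move=> /ore_sumE {1}->; rewrite na_mul_suml coef_sum; apply: eq_bigr => i _.
by rewrite mul_monomE coef_constM.
Qed.

Lemma deg_lt_XM q n : deg_lt q n -> deg_lt (X ** q) n.+1.
Proof.
move=> qn [|k] //; rewrite ltnS coef_XM => nk.
by rewrite !qn ?leqW ?raddf0 ?addr0.
Qed.

Lemma deg_lt_iterXM q n m : deg_lt q n -> deg_lt (iter m (na_mul X) q) (m + n).
Proof. by move=> qn; elim: m => //= m IH; apply: deg_lt_XM. Qed.

Lemma lead_iterXM q n m : deg_lt q n.+1 ->
  (iter m (na_mul X) q)@_(m + n)%N = q@_n.
Proof.
move=> qn; elim: m => //= m IH; rewrite addSn coef_XM IH.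
by rewrite (deg_lt_iterXM qn) ?raddf0 ?add0r // addnS.
Qed.

Lemma deg_ltM p q m n : deg_lt p m -> deg_lt q n.+1 -> deg_lt (p ** q) (m + n).
Proof.
move=> pm qn k mnk; rewrite (coefM _ _ pm) big1 // => i _.
rewrite (deg_lt_iterXM qn) ?na_mulr0 //; apply: leq_trans mnk.
by rewrite addnS -addSn leq_add2r.
Qed.

Lemma leadM p q m n : deg_lt p m.+1 -> deg_lt q n.+1 ->
  (p ** q)@_(m + n)%N = p@_m ** q@_n.
Proof.
move=> pm qn; rewrite (coefM _ _ pm) big_ord_recr /= lead_iterXM //.
rewrite big1 ?add0r // => i _; rewrite (deg_lt_iterXM qn) ?na_mulr0 //.
by rewrite addnS -addSn leq_add2r.
Qed.

Lemma deg_ltMC p a n : deg_lt p n -> deg_lt (p ** C a) n.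
Proof.
by move=> pn; rewrite -[n]addn0; apply: deg_ltM => //; apply: deg_ltC.
Qed.

Lemma deg_ltCM p a n : deg_lt p n -> deg_lt (C a ** p) n.
Proof. by move=> pn k nk; rewrite coef_constM pn ?na_mulr0. Qed.

Lemma leadMC p a n : deg_lt p n.+1 -> (p ** C a)@_n = p@_n ** a.
Proof.
move=> pn; rewrite -[n in LHS]addn0 (leadM pn (@deg_ltC a)) coefC.
by rewrite mulr1n.
Qed.

Lemma monic_mul_eq0 q b g d : b@_d = na_one -> deg_lt b d.+1 -> deg_lt g d ->
  q ** b + g = 0 -> q = 0.
Proof.
move=> b1 bd gd e; apply: contrapT => /deg_lt_exact[n qn0 qn]; apply: qn0.
move/(congr1 (fun p : D => p@_(n + d)%N)): e.
by rewrite coefD coef0 (leadM qn bd) b1 na_mulr1 (gd _ (leq_addl _ _)) addr0.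
Qed.

Lemma divide_monic f b d : b@_d = na_one -> deg_lt b d.+1 ->
  exists q r : D, f = q ** b + r /\ deg_lt r d.
Proof.
move=> b1 bd.
have [N] : exists N, deg_lt f (N + d).
  by exists (ore_deg f).+1; apply: deg_ltW (@deg_lt_ore_deg f); rewrite leq_addr.
elim: N f => [|N IH] f fN; first by exists 0, f; rewrite na_mul0r add0r.
(* [m b] has the same leading term as [f]. *)
pose m := monom f@_(N + d)%N N.
have mN : deg_lt m N.+1.
  by move=> k Nk; rewrite coef_monom; case: eqP => // e; rewrite -e ltnn in Nk.
have [|q [r [e rd]]] := IH (f - m ** b).
  apply: deg_ltS; last first.
    rewrite coefB (leadM mN bd) b1 na_mulr1 coef_monom eqxx.
    by rewrite mulr1n subrr.
  by apply: deg_ltB => //; rewrite -addSn; apply: deg_ltM.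
exists (q + m), r; split=> //; apply/eqP; rewrite na_mulDl.
by rewrite addrAC -e subrK.
Qed.

(** ** The center *)

Lemma mul_XnA p q m :
  (p ** monom na_one m) ** q = p ** (monom na_one m ** q).
Proof.
elim: m p q => [|m IH] p q.
  by rewrite const1 na_mulr1 na_mul1r.
by rewrite -addn1 -mul_monomXn -mulA_Xn mul_XA IH !mul_XA.
Qed.

(** The first field is the commutation of [f] with [X]; see [coef_commX]. *)
Record const_central f : Prop := ConstCentral {
  const_central_ker : forall i, delta f@_i = 0;
  const_centralC : forall a, f ** C a = C a ** f;
  const_centralAl : forall a c, (f ** C a) ** C c = f ** (C a ** C c);
  const_centralAm : forall a c, (C a ** f) ** C c = C a ** (f ** C c)
}.

Lemma X_comm_ker f : (forall i, delta f@_i = 0) -> X ** f = f ** X.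
Proof.
move=> df; apply: coefP => k; rewrite coef_XM coef_mulXn df add0r.
by case: k => // k; rewrite subn1.
Qed.

Lemma center_const_central f : Z f -> const_central f.
Proof.
move=> Zf; split=> [i|a|a c|a c].
- have := congr1 (fun p : D => p@_i) (center_comm X Zf).
  rewrite coef_XM coef_mulXn; case: i => [|i]; rewrite ?addr0 //= subn1 /=.
  by rewrite -{1}[f@_i]add0r => /addIr.
- exact: center_comm.
- exact: center_mulAl.
- exact: center_mulAm.
Qed.

Lemma XM_const_left a u :
    (forall r c, kernel delta c -> delta (c ** r) = c ** delta r) ->
  delta a = 0 -> X ** (C a ** u) = C a ** (X ** u).
Proof.
move=> dl da; apply: coefP => k; rewrite coef_constM !coef_XM na_mulDr.
rewrite coef_constM dl //; congr (_ + _).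
by case: k => [|k]; rewrite ?na_mulr0 ?coef_constM.
Qed.

Lemma XM_const_right f c :
    (forall r a, kernel delta a -> delta (r ** a) = delta r ** a) ->
    (forall i, delta f@_i = 0) ->
  X ** (C c ** f) = (X ** C c) ** f.
Proof.
move=> dr df.
have -> : X ** C c = C (delta c) + C c ** X.
  apply: coefP => k; rewrite coef_XM coefD !coefC coef_constM coef_monom.
  rewrite raddfMn na_mulMnr na_mulr1; congr (_ + _).
  by case: k => [|k]; rewrite ?mulr0n // coefC eqSS eq_sym.
rewrite na_mulDl mul_XA; apply: coefP => k.
rewrite coef_XM coefD !coef_constM coef_XM df add0r dr; last exact: df.
by congr (_ + _); case: k => [|k]; rewrite ?na_mulr0 ?coef_constM.
Qed.

Section Kernel.
Hypothesis kdelta : kernel_derivation delta.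

(** The only place where [X] fails to associate is [(X a) c <> X (a c)]. For
    [f] in the middle position this failure disappears: a left linear [delta]
    lets [X] jump over the coefficients of [f], and for a right linear one
    [X (f c) = X (c f) = (X c) f = f (X c) = (f X) c = (X f) c]. *)
Lemma const_central_XA f c : (forall p, f ** p = p ** f) ->
    (forall i, delta f@_i = 0) ->
  (X ** f) ** C c = X ** (f ** C c).
Proof.
move=> fC df; rewrite X_comm_ker // mul_XA.
case: kdelta => [dr|dl].
  by rewrite (fC (C c)) (XM_const_right c dr df) fC.
rewrite (ore_sumE (@deg_lt_ore_deg f)) !na_mul_suml na_mul_sumr.
apply: eq_bigr => i _; rewrite 2!(mul_monomE _ i) -iterSr iterS.
by rewrite (XM_const_left _ dl) ?df.
Qed.

(** Powers of [X] can be pulled out of every product on the right, can be moved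
    from one factor to the next, and commute with [f]; this reduces all
    commutators and associators with [f] to those with constants. *)
Lemma const_central_center f : const_central f -> Z f.
Proof.
case=> df fC fAl fAm.
have fX : X ** f = f ** X by apply: X_comm_ker.
have fXn m : monom na_one m ** f = f ** monom na_one m.
  elim: m => [|m IH]; first by rewrite const1 na_mul1r na_mulr1.
  by rewrite mul_XnS IH -X_mulA_Xn fX mulA_Xn mul_monomXn.
have fcomm p : f ** p = p ** f.
  apply: (@ore_additive_ext _ (fun p => f ** p)
    (fun p => p ** f)) => [u v|u v|a m].
  - by rewrite na_mulDr.
  - by rewrite na_mulDl.
  by rewrite mul_monomA fXn monom_const_Xn -!mulA_Xn fC.
have extC (F G : D -> D) : {morph F : u v / u + v} -> {morph G : u v / u + v} ->
    (forall q n, F (q ** monom na_one n) = F q ** monom na_one n) ->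
    (forall q n, G (q ** monom na_one n) = G q ** monom na_one n) ->
    (forall c, F (C c) = G (C c)) -> forall q, F q = G q.
  move=> FD GD FX GX FG; apply: ore_additive_ext => // a m.
  by rewrite monom_const_Xn FX GX FG.
(* On the second argument powers of [X] come out on the right, so constants
   suffice. *)
have fCA a q : (f ** C a) ** q = f ** (C a ** q).
  by apply: (extC (fun q => _ ** q)
    (fun q => f ** (C a ** q))) => [u v|u v|u n|u n|c];
    rewrite ?na_mulDr ?mulA_Xn // -?mulA_Xn.
have CfA a q : (C a ** f) ** q = C a ** (f ** q).
  by apply: (extC (fun q => _ ** q)
    (fun q => C a ** (f ** q))) => [u v|u v|u n|u n|c];
    rewrite ?na_mulDr ?mulA_Xn // -?mulA_Xn.
have XfA q : (X ** f) ** q = X ** (f ** q).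
  apply: (extC (fun q => _ ** q)
    (fun q => X ** (f ** q))) => [u v|u v|u n|u n|c];
    rewrite ?na_mulDr ?mulA_Xn // -?mulA_Xn //.
  exact: const_central_XA.
have XnfA m q : f ** (monom na_one m ** q) = monom na_one m ** (f ** q).
  rewrite !mul_XnE; elim: m => //= m IH.
  by rewrite -mul_XA -fX XfA IH.
have ext1 (F G : D -> D) : {morph F : u v / u + v} -> {morph G : u v / u + v} ->
    (forall a m, F (C a ** monom na_one m) = G (C a ** monom na_one m)) ->
    forall p, F p = G p.
  move=> FD GD FG; apply: ore_additive_ext => // a m.
  by rewrite monom_const_Xn FG.
apply: centerI => // p q.
  apply: (ext1 (fun p => (f ** p) ** q)
    (fun p => f ** (p ** q))) => [u v|u v|a m].
  - by rewrite na_mulDr na_mulDl.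
  - by rewrite na_mulDl na_mulDr.
  by rewrite -mulA_Xn mul_XnA fCA mul_XnA.
apply: (ext1 (fun p => (p ** f) ** q)
  (fun p => p ** (f ** q))) => [u v|u v|a m].
- by rewrite !na_mulDl.
- by rewrite na_mulDl.
by rewrite mul_XnA fXn -mulA_Xn mul_XnA CfA XnfA mul_XnA.
Qed.

Lemma center_lead f n : Z f -> deg_lt f n.+1 -> center_kernel delta f@_n.
Proof.
move=> Zf fn; have [df fC fAl fAm] := center_const_central Zf.
split; last exact: df.
apply: centerI => [s|s t|s t].
- by rewrite -leadMC // fC coef_constM.
- rewrite -leadMC // -leadMC; last exact: deg_ltMC.
  by rewrite fAl -constM leadMC.
- rewrite -coef_constM -leadMC; last exact: deg_ltCM.
  by rewrite fAm coef_constM leadMC.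
Qed.

Lemma const_center a : center_kernel delta a -> Z (C a).
Proof.
case=> Za da; apply: const_central_center; split=> [i|s|s t|s t].
- by rewrite coefC raddfMn da mul0rn.
- by rewrite -!constM (center_comm _ Za).
- by rewrite -!constM (center_mulAl _ _ Za).
- by rewrite -!constM (center_mulAm _ _ Za).
Qed.

Lemma center_deg_lt1 f : Z f -> deg_lt f 1 ->
  exists2 a, center_kernel delta a & f = C a.
Proof.
by move=> Zf f1; exists f@_0; [apply: center_lead|apply: deg_lt1].
Qed.

(** ** Hasse derivatives *)

(** [hasse k] is the divided derivative [d^k / k! dX^k]. *)
Definition hasse k p : D :=
  \sum_(m < (ore_deg p).+1) monom (p@_(m : nat) *+ 'C(m, k)) (m - k).

Lemma coef_hasse k p j : (hasse k p)@_j = p@_(j + k)%N *+ 'C(j + k, k).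
Proof.
rewrite /hasse coef_sum.
have small m : (m - k == j)%N -> m != (j + k)%N -> 'C(m, k) = 0%N.
  move=> /eqP <-; case: (leqP k m) => [km|mk _]; last by rewrite bin_small.
  by rewrite subnK // eqxx.
have [lt|ge] := ltnP (j + k) (ore_deg p).+1; last first.
  rewrite deg_lt_ore_deg // mul0rn big1 // => m _; rewrite coef_monom.
  case: eqP => [/eqP /small -> //|]; rewrite ?mulr0n ?mul0rn //.
  by apply: contraL ge => /eqP <-; rewrite -ltnNge ltn_ord.
rewrite (bigD1 (Ordinal lt)) //= big1 ?addr0 => [|m mjk]; rewrite coef_monom.
  by rewrite addnK eqxx mulr1n.
case: eqP => [/eqP /small -> //|]; rewrite ?mulr0n ?mul0rn //.
Qed.

Lemma hasseD k : {morph hasse k : p q / p + q}.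
Proof.
by move=> p q; apply: coefP => j; rewrite coefD !coef_hasse coefD mulrnDl.
Qed.

Lemma hasse_constM k a q : hasse k (C a ** q) = C a ** hasse k q.
Proof.
by apply: coefP => j; rewrite coef_constM !coef_hasse coef_constM na_mulMnr.
Qed.

(** Both sides are [m! / (j! k! (m - j - k)!)]. *)
Lemma bin_mul_bin m j k :
  ('C(m, j + k) * 'C(j + k, k) = 'C(m, k) * 'C(m - k, j))%N.
Proof.
have [le|lt] := leqP (j + k) m; last first.
  rewrite (bin_small lt) mul0n; have [km|mk] := leqP k m.
    by rewrite (@bin_small (m - k)) ?muln0 // ltn_subLR // addnC.
  by rewrite (@bin_small m k).
have km : (k <= m)%N by apply: leq_trans le; apply: leq_addl.
have jm : (j <= m - k)%N by rewrite leq_subRL // addnC.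
apply/eqP; rewrite -(eqn_pmul2r (fact_gt0 k)) -(eqn_pmul2r (fact_gt0 j)).
rewrite -(eqn_pmul2r (fact_gt0 (m - k - j))); apply/eqP.
have := bin_fact le; have := bin_fact (leq_addl j k); rewrite addnK.
have := bin_fact km; have := bin_fact jm; rewrite subnDA.
rewrite (subnAC m j k) => E1 E2 E3 E4.
transitivity m`!; first by rewrite -E4 -E3 !mulnA.
by rewrite -E2 -E1 !mulnA (mulnAC 'C(m, k)).
Qed.

Lemma hasse_Mconst k p c : hasse k (p ** C c) = hasse k p ** C c.
Proof.
apply: (@ore_additive_ext _ (fun p => hasse k (p ** C c))
  (fun p => hasse k p ** C c)) => [u v|u v|a m].
- by rewrite na_mulDl hasseD.
- by rewrite hasseD na_mulDl.
have -> : hasse k (monom a m) = monom (a *+ 'C(m, k)) (m - k).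
  apply: coefP => j; rewrite coef_hasse !coef_monom.
  have [km|mk] := leqP k m; last first.
    by case: eqP => [<-|_]; rewrite ?mul0rn // bin_small // ?mul0rn.
  rewrite -{1}(subnK km) eqn_add2r; case: eqP => [<-|_]; rewrite ?mul0rn //.
  by rewrite subnK // mulr1n.
apply: coefP => j; rewrite coef_hasse.
rewrite (mul_monomE a m) (mul_monomE _ (m - k)) !coef_constM.
rewrite !coef_iterXM_monom !subn0 !na_mulMnr na_mulMnl -!mulrnA.
by rewrite bin_mul_bin mulnC addnC subnDA mulnC.
Qed.

(** Centrality only has to be tested against constants, and Hasse derivatives
    commute with the multiplications by constants on both sides. *)
Lemma hasse_center k f : Z f -> Z (hasse k f).
Proof.
move=> /center_const_central[df fC fAl fAm]; apply: const_central_center.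
split=> [i|a|a c|a c].
- by rewrite coef_hasse raddfMn df mul0rn.
- by rewrite -hasse_Mconst -hasse_constM fC.
- by rewrite -constM -!hasse_Mconst fAl -constM.
- by rewrite -hasse_Mconst -!hasse_constM -hasse_Mconst fAm.
Qed.

(** * Delta-simple rings *)

Lemma center_kernel0 : center_kernel delta 0.
Proof. by split; [apply: center0|apply: raddf0]. Qed.

Lemma center_kernel1 : center_kernel delta na_one.
Proof. by split; [apply: center1|]. Qed.

Lemma delta_centerM a s :
  center_kernel delta a -> delta (a ** s) = a ** delta s.
Proof.
case=> Za da; case: kdelta => [dr|dl]; last exact: dl.
by rewrite !(center_comm _ Za) dr.
Qed.

Section DeltaSimple.
Hypothesis sdelta : delta_simple delta.

Lemma delta_simple_setT (I : set R) a :
  ideal I -> Defs.invariant delta I -> I a -> a <> 0 -> I = setT.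
Proof.
by move=> iI dI Ia a0; case: (sdelta iI dI) => // I0; move: Ia; rewrite I0.
Qed.

Lemma center_kernel_inv a : center_kernel delta a -> a <> 0 ->
  exists2 y, center_kernel delta y & a ** y = na_one.
Proof.
move=> Fa a0; have [Za da] := Fa; have iI := principal_ideal Za.
have IT : [set a ** s | s in setT] = setT.
  apply: (delta_simple_setT (a := a)) => //; last first.
    by exists na_one; rewrite ?na_mulr1.
  by move=> _ [s _ <-]; exists (delta s); rewrite ?delta_centerM.
have [y _ ay1] : [set a ** s | s in setT] na_one by rewrite IT.
have Zy := center_inv Za ay1.
exists y => //; split=> //; rewrite /kernel /=.
rewrite -[delta y]na_mul1r -ay1 (center_comm _ Za) (center_mulAm _ _ Za).
by rewrite -delta_centerM // ay1 delta1 na_mulr0.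
Qed.

(** The [n]-torsion is a delta-invariant ideal. *)
Lemma torsion_free r n : (na_one *+ n : R) <> 0 -> r *+ n = 0 -> r = 0.
Proof.
move=> n1 rn; apply: contrapT => r0; apply: n1.
suff: [set s : R | s *+ n = 0] = setT by move/seteqP => [_ /(_ na_one)]; apply.
apply: (delta_simple_setT (a := r)) => // [|s /= sn].
  split=> [|s t /= sn tn|s t /= tn|s t /= tn] /=.
  - by rewrite mul0rn.
  - by rewrite mulrnBl sn tn subrr.
  - by rewrite -na_mulMnr tn na_mulr0.
  - by rewrite -na_mulMnl tn na_mul0r.
by rewrite -raddfMn sn raddf0.
Qed.

Lemma char_prime (p : nat) : (0 < p)%N -> has_char R p -> prime p.
Proof.
move=> p0 chR; apply/primeP; split=> [|d /dvdnP[e pE]].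
  case: p p0 chR => [|[|p]] // _ /(_ 1%N) [_ H].
  by case: (@na_oner_neq0 R); rewrite -[LHS]mulr1n H.
case: (boolP (p %| e)%N) => [pe|Npe].
  have ep : e = p by apply/eqP; rewrite eqn_dvd pe andbT pE dvdn_mulr.
  apply/orP; left; rewrite -(eqn_pmul2l p0) muln1.
  by rewrite -{1}ep mulnC mulnC -pE.
have pd : (p %| d)%N.
  apply/(chR d).1/(@torsion_free _ e); first by move/(chR e).1; apply/negP.
  by rewrite -mulrnA mulnC -pE; apply/(chR p).2.
by apply/orP; right; rewrite eqn_dvd pd andbT pE dvdn_mull.
Qed.

(** ** Ideals of the polynomial ring *)

Lemma coef_commX f k : (X ** f - f ** X)@_k = delta f@_k.
Proof.
rewrite coefB coef_XM coef_mulXn.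
by case: k => [|k] /=; rewrite ?subn1 ?addr0 ?subr0 ?addrK.
Qed.

(** The coefficients of [X^n] in the elements of minimal degree [n] form,
    together with 0, a delta-invariant ideal, because [X f - f X] has the
    coefficients [delta f@_k]. *)
Lemma min_monic (I : set D) : ideal I -> I <> [set 0] ->
  exists f n, [/\ I f, f@_n = na_one, deg_lt f n.+1 &
                  forall g, I g -> deg_lt g n -> g = 0].
Proof.
move=> iI I0.
pose P n := exists g, [/\ I g, g <> 0 & deg_lt g n.+1].
have [n0 Pn0] : exists n, P n.
  apply: contrapT => NP; apply: I0; apply/seteqP; split=> [g Ig|_ ->] /=.
    apply: contrapT => g0; apply: NP; exists (ore_deg g), g; split=> //.
    exact: deg_lt_ore_deg.
  exact: ideal0.
have exP : exists n, `[< P n >] by exists n0; apply/asboolP.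
case: (ex_minnP exP) => n /asboolP[g [Ig g0 gn]] minn.
have small h : I h -> deg_lt h n -> h = 0.
  move=> Ih; case: n minn {gn} => [_ /deg_lt0 //|n minn hn].
  apply: contrapT => h0; suff: (n.+1 <= n)%N by rewrite ltnn.
  by apply: minn; apply/asboolP; exists h.
pose J := [set r | exists f, [/\ I f, deg_lt f n.+1 & f@_n = r]].
have JT : J = setT.
  apply: (delta_simple_setT (a := g@_n)); first 1 last.
  - move=> _ [f [If fn <-]]; exists (X ** f - f ** X); split.
    + by apply: idealB => //; [apply: Defs.idealMl|apply: Defs.idealMr].
    + by move=> k nk; rewrite coef_commX fn ?raddf0.
    + by rewrite coef_commX.
  - by exists g.
  - by move/(deg_ltS gn)/(small _ Ig).
  split=> [|_ _ [f [If fn <-]] [h [Ih hn <-]]|r _ [f [If fn <-]]|r _ [f [If fn <-]]].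
  - exists 0; split; [exact: ideal0|exact: deg_lt_zero|exact: coef0].
  - exists (f - h); split; [exact: idealB|exact: deg_ltB|exact: coefB].
  - exists (C r ** f); split; [exact: Defs.idealMl|exact: deg_ltCM|].
    exact: coef_constM.
  - exists (f ** C r); split; [exact: Defs.idealMr|exact: deg_ltMC|].
    exact: leadMC.
have [f [If fn f1]] : J na_one by rewrite JT.
by exists f, n.
Qed.

(** Commutators and associators of a monic [f] with constants, and its
    commutator with [X], have degree smaller than that of [f]. *)
Lemma min_monic_center (I : set D) f n : ideal I -> I f -> f@_n = na_one ->
    deg_lt f n.+1 -> (forall g, I g -> deg_lt g n -> g = 0) ->
  Z f.
Proof.
move=> iI If f1 fn small.
have small2 g h : I g -> I h -> deg_lt g n.+1 -> deg_lt h n.+1 ->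
    g@_n = h@_n -> g = h.
  move=> Ig Ih gn hn gh; apply/eqP; rewrite -subr_eq0; apply/eqP; apply: small.
    exact: idealB.
  by apply: deg_ltS; [apply: deg_ltB|rewrite coefB gh subrr].
have IMl (h g : D) : I g -> I (h ** g) by apply: Defs.idealMl.
have IMr (h g : D) : I g -> I (g ** h) by apply: Defs.idealMr.
apply: const_central_center; split=> [i|a|a c|a c].
- rewrite -coef_commX [X in X@_i](_ : _ = 0) ?coef0 //.
  apply: small => [|k]; first by apply: idealB => //; auto.
  rewrite leq_eqVlt => /orP[/eqP <-|nk]; rewrite coef_commX ?f1 //.
  by rewrite fn ?raddf0.
- apply: small2; auto; [exact: deg_ltMC|exact: deg_ltCM|].
  by rewrite leadMC // coef_constM f1 na_mul1r na_mulr1.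
- rewrite -constM; apply: small2; auto.
  + by do 2 apply: deg_ltMC.
  + exact: deg_ltMC.
  rewrite leadMC; last exact: deg_ltMC.
  by rewrite !leadMC // f1 !na_mul1r.
- apply: small2; auto.
  + by apply: deg_ltMC; apply: deg_ltCM.
  + by apply: deg_ltCM; apply: deg_ltMC.
  rewrite leadMC; last exact: deg_ltCM.
  by rewrite !coef_constM leadMC // f1 na_mul1r na_mulr1.
Qed.

Lemma ideal_center_generator (I : set D) : ideal I -> I <> [set 0] ->
  exists f, [/\ ore_monic f, Z f & I = ideal_generated f].
Proof.
move=> iI I0; have [f [n [If f1 fn small]]] := min_monic iI I0.
have Zf := min_monic_center iI If f1 fn small.
exists f; split=> //; first by apply/ore_monicP; exists n.
rewrite ideal_generated_center //; apply/seteqP; split=> [g Ig|_ [s _ <-]].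
  have [q [r [gE rn]]] := divide_monic g f1 fn.
  exists q; rewrite // (center_comm _ Zf) gE [r]small ?addr0 //.
  have -> : r = g - q ** f by rewrite gE addrC addKr.
  by apply: idealB => //; apply: Defs.idealMl.
exact: Defs.idealMr.
Qed.

End DeltaSimple.

Lemma multiple_small q b d :
  b@_d = na_one -> deg_lt b d.+1 -> deg_lt (q ** b) d -> q = 0.
Proof.
move=> b1 bd qbd; apply: (monic_mul_eq0 (g := - (q ** b)) b1 bd).
  by move=> k dk; rewrite coefN qbd ?oppr0.
exact: subrr.
Qed.

Lemma monic_neq0 b d : b@_d = na_one -> b <> 0.
Proof. by move=> b1 b0; move: b1; rewrite b0 coef0 => /esym/na_oner_neq0. Qed.

(** Each of [f] and [g] is a multiple of the other, so they have the same degree,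
    and [g - f] is a multiple of [f] of smaller degree. *)
Lemma ideal_monic_unique f g : ore_monic f -> ore_monic g -> Z f -> Z g ->
  ideal_generated f = ideal_generated g -> f = g.
Proof.
move=> /ore_monicP[n f1 fn] /ore_monicP[m g1 gm] Zf Zg.
rewrite (ideal_generated_center Zf) (ideal_generated_center Zg) => fg.
have [s gE] : exists s, s ** f = g.
  have [s _ <-] : [set f ** s | s in setT] g.
    by rewrite fg; exists na_one; rewrite ?na_mulr1.
  by exists s; rewrite (center_comm _ Zf).
have [t fE] : exists t, t ** g = f.
  have [t _ <-] : [set g ** t | t in setT] f.
    by rewrite -fg; exists na_one; rewrite ?na_mulr1.
  by exists t; rewrite (center_comm _ Zg).
have nm : n = m.
  apply/eqP; rewrite eqn_leq; apply/andP; split; rewrite leqNgt; apply/negP => lt.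
    have s0 : s = 0.
      by apply: (multiple_small f1 fn); rewrite gE; apply: deg_ltW gm.
    by case: (monic_neq0 g1); rewrite -gE s0 na_mul0r.
  have t0 : t = 0.
    by apply: (multiple_small g1 gm); rewrite fE; apply: deg_ltW fn.
  by case: (monic_neq0 f1); rewrite -fE t0 na_mul0r.
apply/esym/eqP; rewrite -subr_eq0; apply/eqP.
have E : (s - na_one) ** f = g - f by rewrite na_mulBl gE na_mul1r.
rewrite -E (_ : s - na_one = 0) ?na_mul0r //.
apply: (multiple_small f1 fn); rewrite E; apply: deg_ltS.
  by apply: deg_ltB => //; rewrite nm.
by rewrite coefB f1 nm g1 subrr.
Qed.

(** * The generator of the center *)

(** Quotient and remainder in the division of a central element by a monic
    central [b] are central: commutators and associators with constants turn
    [q b + r] into [q' b + r'] with [r'] still of degree smaller than [b], and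
    a vanishing [q' b + r'] has [q' = 0]. *)
Lemma divide_center q b g d : Z b -> b@_d = na_one -> deg_lt b d.+1 ->
  deg_lt g d -> Z (q ** b + g) -> Z q.
Proof.
move=> Zb b1 bd gd Zf.
have [df fC fAl fAm] := center_const_central Zf.
have bA s t : s ** (t ** b) = (s ** t) ** b by rewrite (center_mulAr _ _ Zb).
have bAC s t : (s ** b) ** t = (s ** t) ** b.
  by rewrite (center_mulAm _ _ Zb) (center_comm _ Zb) bA.
have eq0 u v s t : deg_lt v d -> deg_lt t d -> u ** b + v = s ** b + t -> u = s.
  move=> vd td e; apply/eqP; rewrite -subr_eq0; apply/eqP.
  apply: (monic_mul_eq0 (g := v - t) b1 bd); first exact: deg_ltB.
  by rewrite na_mulBl addrACA e -opprD subrr.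
apply: const_central_center; split=> [i|a|a c|a c].
- rewrite -coef_commX [X in X@_i](_ : _ = 0) ?coef0 //.
  apply: (monic_mul_eq0 (g := X ** g - g ** X) b1 bd).
    by move=> k dk; rewrite coef_commX gd ?raddf0.
  rewrite na_mulBl -bA -bAC addrACA -opprD -na_mulDr -na_mulDl.
  by rewrite (center_comm X Zf) subrr.
- have := fC a; rewrite na_mulDl na_mulDr bAC bA.
  by apply: eq0; [apply: deg_ltMC|apply: deg_ltCM].
- have := fAl a c; rewrite !na_mulDl !bAC -!constM; apply: eq0.
    by do 2 apply: deg_ltMC.
  exact: deg_ltMC.
- have := fAm a c; rewrite !(na_mulDl, na_mulDr) !(bA, bAC); apply: eq0.
    by apply: deg_ltMC; apply: deg_ltCM.
  by apply: deg_ltCM; apply: deg_ltMC.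
Qed.

Local Notation F := (center_kernel delta).
Local Notation exprs := (poly_exprs (center_kernel delta)).

Lemma exprs_const b a : F a -> exprs b (C a).
Proof.
move=> Fa; exists 1%N, (fun _ => a); split=> //.
by rewrite big_ord1 constE na_mulr1.
Qed.

Lemma exprs_step b q a : Z b -> F a -> exprs b q -> exprs b (q ** b + C a).
Proof.
move=> Zb Fa [n [z [Fz ->]]].
exists n.+1, (fun i => if i is j.+1 then z j else a).
split=> [[|i] //|]; first exact: Fz.
rewrite big_ord_recl addrC constE na_mulr1 na_mul_suml; congr (_ + _).
apply: eq_bigr => i _ /=.
by rewrite (center_mulAr _ _ Zb) -(center_comm _ Zb).
Qed.

Lemma exprs_divide b f : Z b -> exprs b f ->
  exists q, exists2 a, F a & f = q ** b + C a.
Proof.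
move=> Zb [[|n] [z [Fz ->]]].
  exists 0, 0; first exact: center_kernel0.
  by rewrite big_ord0 monom0 na_mul0r addr0.
exists (\sum_(i < n) C (z i.+1) ** na_exp b i), (z 0%N); first exact: Fz.
rewrite big_ord_recl addrC constE na_mulr1 na_mul_suml; congr (_ + _).
apply: eq_bigr => i _; rewrite constE /=.
by rewrite (center_mulAr _ _ Zb) -(center_comm _ Zb).
Qed.

Lemma exprs_center b f : Z b -> exprs b f -> Z f.
Proof.
move=> Zb [n [z [Fz ->]]].
apply: (big_ind (fun f => Z f)) => [|u v|i _]; [exact: center0|exact: centerD|].
apply: centerM; first by rewrite constE; apply: const_center; apply: Fz.
by elim: (i : nat) => [|m IH]; [apply: center1|apply: centerM].
Qed.

Lemma exprs1_deg_lt f : exprs na_one f -> deg_lt f 1.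
Proof.
move=> [n [z [Fz ->]]].
apply: (big_ind (fun f => deg_lt f 1)) => [|u v|i _].
- exact: deg_lt_zero.
- exact: deg_ltD.
have -> : na_exp (na_one : D) i = na_one.
  by elim: (i : nat) => //= m ->; rewrite na_mul1r.
by rewrite na_mulr1 constE; apply: deg_ltC.
Qed.

Lemma center_generator_center b : center_generator b -> Z b.
Proof.
case=> _ _ ->; exists 2%N, (fun i => if i is 0 then 0 else na_one).
split=> [[|i] _|]; [exact: center_kernel0|exact: center_kernel1|].
rewrite big_ord_recr big_ord1 /= !constE monom0 na_mul0r add0r const1.
by rewrite na_mul1r na_mulr1.
Qed.

Lemma center_generator_deg0 b : center_generator b -> deg_lt b 1 -> b = na_one.
Proof.
case=> /ore_monicP[n b1 bn] _ _ bs; rewrite (deg_lt1 bs).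
case: n b1 bn => [-> _|n]; first exact: const1.
by rewrite bs // => /esym/na_oner_neq0.
Qed.

Lemma center_generator1_deg_lt b f :
  center_generator b -> deg_lt b 1 -> Z f -> deg_lt f 1.
Proof.
move=> gb b1; case: (gb) => _ _ ->; rewrite (center_generator_deg0 gb b1).
exact: exprs1_deg_lt.
Qed.

(** A central element is [q b + a] with [a] constant, and its degree is at least
    that of [b] unless [q = 0]. *)
Lemma center_generator_min b d f : center_generator b -> b@_d = na_one ->
  deg_lt b d.+1 -> Z f -> deg_lt f d -> deg_lt f 1.
Proof.
move=> gb b1 bd; have Zb := center_generator_center gb.
case: d b1 bd => [|d] b1 bd Zf fd.
  by apply: deg_ltW fd.
move: Zf; case: (gb) => _ _ -> /(exprs_divide Zb)[q [a Fa fE]].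
have q0 : q = 0.
  apply: (monic_mul_eq0 (g := C a - f) b1 bd).
    by apply: deg_ltB => //; apply: deg_ltW (@deg_ltC a).
  by rewrite addrA -fE subrr.
by rewrite fE q0 na_mul0r add0r; apply: deg_ltC.
Qed.

(** In the division of a central element by [b] the remainder is central, hence
    constant by minimality, and the quotient is central of smaller degree. *)
Lemma min_center_exprs b d : Z b -> b@_d = na_one -> deg_lt b d.+1 ->
    (0 < d)%N -> (forall g, Z g -> deg_lt g d -> deg_lt g 1) ->
  forall f, Z f -> exprs b f.
Proof.
move=> Zb b1 bd d0 small f; have := @deg_lt_ore_deg f.
move: (ore_deg f).+1 => N; elim: N f => [|N IH] f fN Zf.
  rewrite (deg_lt0 fN) -(monom0 0).
  by apply: exprs_const; apply: center_kernel0.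
have [q [g [fE gd]]] := divide_monic f b1 bd.
have Zq : Z q by apply: (divide_center Zb b1 bd gd); rewrite -fE.
have gE : g = f - q ** b by rewrite fE addrC addKr.
have Zg : Z g by rewrite gE; exact: centerB Zf (centerM Zq Zb).
have [a Fa gC] := center_deg_lt1 Zg (small _ Zg gd).
rewrite fE gC; refine (exprs_step Zb Fa (IH _ _ Zq)).
have [->|/deg_lt_exact[m qm0 qm]] := pselect (q = 0); first exact: deg_lt_zero.
apply: (deg_ltW _ qm); rewrite ltnNge; apply/negP => Nm; apply: qm0.
rewrite -[q@_m]na_mulr1 -b1 -leadM //.
have -> : q ** b = f - g by rewrite fE addrK.
rewrite coefB fN ?gd ?subrr ?leq_addl //.
by rewrite -addn1; apply: leq_add.
Qed.

Lemma center_generator_exists : delta_simple delta ->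
  exists b : D, center_generator b.
Proof.
move=> sdelta.
have [const|nonconst] := pselect (forall f, Z f -> deg_lt f 1).
  exists na_one; split.
  - apply/ore_monicP; exists 0%N; rewrite -const1 ?coefC //.
    exact: deg_ltC.
  - by move=> i; rewrite -const1 coefC /kernel /= raddfMn delta1 mul0rn.
  apply/seteqP; split=> f.
    move=> Zf; have [a Fa ->] := center_deg_lt1 Zf (const f Zf).
    exact: exprs_const.
  by apply: exprs_center; apply: center1.
pose P n := exists f, [/\ Z f, ~ deg_lt f 1 & deg_lt f n.+1].
have exP : exists n, `[< P n >].
  apply: contrapT => NP; apply: nonconst => f Zf; apply: contrapT => f1.
  apply: NP; exists (ore_deg f); apply/asboolP; exists f; split=> //.
  exact: deg_lt_ore_deg.
case: (ex_minnP exP) => d /asboolP[f [Zf Nf1 fd]] mind.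
have small g : Z g -> deg_lt g d -> deg_lt g 1.
  move=> Zg; case: d mind {fd} => [_|d mind] gd; first exact: deg_ltW gd.
  apply: contrapT => g1; suff: (d.+1 <= d)%N by rewrite ltnn.
  by apply: mind; apply/asboolP; exists g.
have d0 : (0 < d)%N by case: d fd {mind small}.
have [y Fy fy] : exists2 y, F y & f@_d ** y = na_one.
  apply: center_kernel_inv => //; first exact: center_lead.
  by move/(deg_ltS fd)/(small _ Zf).
pose b := C y ** f.
have Zb : Z b by exact: centerM (const_center Fy) Zf.
have b1 : b@_d = na_one by rewrite coef_constM (center_comm _ Fy.1).
have bd : deg_lt b d.+1 by apply: deg_ltCM.
exists b; split; first by apply/ore_monicP; exists d.
  by move=> i; apply: const_central_ker (center_const_central Zb) i.
apply/seteqP; split=> g; last exact: exprs_center.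
exact: (min_center_exprs Zb b1 bd d0 small).
Qed.

(** The degrees agree by minimality, so the difference is a central element of
    smaller degree, hence a constant. *)
Lemma center_generator_unique b b' : center_generator b -> center_generator b' ->
  exists2 z, F z & b' = b + C z.
Proof.
have key (u v : D) d e : center_generator u -> center_generator v ->
    u@_d = na_one -> deg_lt u d.+1 -> v@_e = na_one -> deg_lt v e.+1 -> (d <= e)%N.
  move=> gu gv u1 ud v1 ve; rewrite leqNgt; apply/negP => ed.
  have v_const : deg_lt v 1.
    apply: (center_generator_min gu u1 ud (center_generator_center gv)).
    exact: deg_ltW ve.
  have := center_generator1_deg_lt gv v_const (center_generator_center gu).
  move/(_ d (leq_ltn_trans (leq0n e) ed)); rewrite u1.
  exact: na_oner_neq0.
move=> gb gb'.
have [[/ore_monicP[d b1 bd] _ _] [/ore_monicP[d' b'1 b'd] _ _]] := (gb, gb').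
have dd' : d' = d.
  apply/eqP; rewrite eqn_leq.
  by rewrite (key b' b d' d) // (key b b' d d').
rewrite {}dd' in b'1 b'd.
have Zbb : Z (b' - b) by apply: centerB; apply: center_generator_center.
have [|a Fa e] := center_deg_lt1 Zbb; last by exists a; rewrite // -e addrC subrK.
apply: (center_generator_min gb b1 bd Zbb).
by apply: deg_ltS; [apply: deg_ltB|rewrite coefB b1 b'1 subrr].
Qed.

(** * Simplicity *)

(** The polynomials with coefficients in a delta-invariant ideal of [R] form an
    ideal of [D]. *)
Lemma simple_delta_simple : simple_ring D -> delta_simple delta.
Proof.
move=> sD J iJ dJ; pose I := [set p : D | forall i, J p@_i].
have IX p m : I p -> I (iter m (na_mul X) p).
  move=> Ip; elim: m => //= m IH k; rewrite coef_XM; apply: idealD => //.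
    by apply: dJ; apply: IH.
  by case: k => [|k]; [apply: ideal0|apply: IH].
have iI : ideal I.
  split=> [i|p q Ip Iq i|p q Iq i|p q Iq i].
  - by rewrite coef0; apply: ideal0.
  - by rewrite coefB; apply: idealB.
  - rewrite (coefM _ _ (@deg_lt_ore_deg p)).
    apply: (big_ind (fun r => J r)) => [|u v|j _]; [exact: ideal0|exact: idealD|].
    by apply: Defs.idealMl => //; apply: IX.
  - rewrite (coefM _ _ (@deg_lt_ore_deg q)).
    apply: (big_ind (fun r => J r)) => [|u v|j _]; [exact: ideal0|exact: idealD|].
    exact: Defs.idealMr.
case: (sD I iI) => [I0|IT]; [left|right].
  apply/seteqP; split=> [r Jr|_ ->]; last exact: ideal0.
  have : I (C r).
    by move=> i; rewrite coefC; case: eqP => // _; rewrite mulr0n; apply: ideal0.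
  by rewrite I0 => /(congr1 (fun p : D => p@_0)); rewrite coefC coef0.
apply: ideal_setT => //; have : I (C na_one) by rewrite IT.
by move/(_ 0%N); rewrite coefC.
Qed.

Lemma simple_center_field : simple_ring D -> field_in Z.
Proof.
move=> sD; split=> [|x y|x y|x y Zx _|x y t Zx _ _|x Zx x0].
- exact: center1.
- exact: centerB.
- exact: centerM.
- exact: center_comm.
- by rewrite center_mulAl.
have [E|E] := sD _ (principal_ideal Zx).
  have : [set x ** s | s in setT] x by exists na_one; rewrite ?na_mulr1.
  by rewrite E => /x0.
have [y _ xy1] : [set x ** s | s in setT] na_one by rewrite E.
exact: ex_intro2 (center_inv Zx xy1) xy1.
Qed.

Lemma field_center_simple :
  delta_simple delta -> field_in Z -> simple_ring D.
Proof.
move=> sdelta fZ I iI; have [->|I0] := pselect (I = [set 0]); [by left|right].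
have [f [[f0 _] Zf IE]] := ideal_center_generator sdelta iI I0.
have [y _ fy1] := field_inV fZ Zf f0.
apply: ideal_setT => //; rewrite IE ideal_generated_center //.
by exists y.
Qed.

(** A monic polynomial of positive degree is not invertible. *)
Lemma field_center_generator b :
  field_in Z -> center_generator b -> deg_lt b 1.
Proof.
move=> fZ gb; have Zb := center_generator_center gb.
have [/ore_monicP[[|d] b1 bd] _ _] := gb; first by [].
have [y Zy by1] := field_inV fZ Zb (monic_neq0 b1).
suff y0 : y = 0 by case: (@na_oner_neq0 D); rewrite -by1 y0 na_mulr0.
apply: (monic_mul_eq0 (g := - C na_one) b1 bd).
  move=> k dk; rewrite coefN (@deg_ltC _ k) ?oppr0 //.
  by apply: leq_trans dk.
by rewrite -(center_comm _ Zb) by1 const1 subrr.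
Qed.

(** * The shape of the generator *)

(** The [k]-th Hasse derivative of the generator [b] is central and of smaller
    degree than [b] when [k > 0], so it is a constant of [F]. *)
Lemma center_generator_hasse b k : center_generator b -> (0 < k)%N ->
  F b@_k /\ forall m, (k < m)%N -> b@_m *+ 'C(m, k) = 0.
Proof.
move=> gb k0; have Zb := center_generator_center gb.
have [/ore_monicP[d b1 bd] _ _] := gb.
have Zh := hasse_center k Zb.
have h1 : deg_lt (hasse k b) 1.
  apply: (center_generator_min gb b1 bd Zh) => j dj.
  by rewrite coef_hasse bd ?mul0rn // -addn1; apply: leq_add.
split=> [|m km]; first by have := center_lead Zh h1; rewrite coef_hasse binn.
have := h1 (m - k)%N; rewrite coef_hasse subnK; last exact: ltnW.
by apply; rewrite subn_gt0.
Qed.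

Lemma coef0_monomM a m r : (monom a m ** C r)@_0 = a ** iter m delta r.
Proof. by rewrite mul_monomE coef_constM coef_iterXM_monom subnn subn0 bin0. Qed.

(** With [k = 1], ['C(m, 1) b_m = m b_m] vanishes for [m > 1]. *)
Lemma center_generator_char0 b : delta_simple delta -> has_char R 0 ->
    center_generator b ->
  b = na_one \/
  exists c, [/\ kernel delta c, b = C c + X &
                forall r, delta r = - inner_der c r].
Proof.
move=> sdelta ch0 gb; have [/ore_monicP[d b1 bd] kb _] := gb.
have bm m : (1 < m)%N -> b@_m = 0.
  move=> m1; apply: (torsion_free sdelta (n := m)).
    by move/(ch0 m).1; rewrite dvd0n; case: m m1.
  by have [_ /(_ m m1)] := center_generator_hasse gb (ltn0Sn 0); rewrite bin1.
case: d b1 bd => [_ bd|[|d] b1 bd]; first by left; apply: center_generator_deg0.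
  right; exists b@_0; split=> [||r]; first exact: kb.
    rewrite {1}(ore_sumE bd) big_ord_recr big_ord1 /=.
    by rewrite b1.
  have := congr1 (fun p : D => p@_0)
    (center_comm (C r) (center_generator_center gb)).
  rewrite {1}(ore_sumE bd) big_ord_recr big_ord1 /= b1 na_mulDl coefD.
  rewrite !coef0_monomM coef_constM /= na_mul1r /inner_der opprB => <-.
  by rewrite addrAC subrr add0r.
by case: (@na_oner_neq0 R); rewrite -b1 bm.
Qed.

(** An exponent [m > 0] of [b] that is not a power of [p] has some ['C(m, k)]
    prime to [p], so its coefficient is a torsion element. This applies to the
    degree of [b] as well. *)
Lemma center_generator_charp b (p : nat) : delta_simple delta -> (0 < p)%N ->
    has_char R p -> center_generator b ->
  b = na_one \/
  exists c n (z : nat -> R),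
    [/\ kernel delta c,
        (forall i, (i <= n)%N -> F (z i)) /\ z n = na_one,
        b = C c + \sum_(i < n.+1) monom (z i) (p ^ i) &
        forall r, \sum_(i < n.+1) z i ** iter (p ^ i) delta r = - inner_der c r].
Proof.
move=> sdelta p0 chp gb; have pp := char_prime sdelta p0 chp.
have [/ore_monicP[d b1 bd] kb _] := gb.
have [d0|d0] := posnP d.
  by left; apply: center_generator_deg0 => //; rewrite d0 in bd.
have bm m : (0 < m)%N -> (forall i, m <> (p ^ i)%N) -> b@_m = 0.
  move=> m0 /(bin_not_dvd pp m0)[k [k0 km Npk]].
  apply: (torsion_free sdelta (n := 'C(m, k))).
    by move/(chp _).1; apply/negP.
  by have [_] := center_generator_hasse gb k0; apply.
have [n dE] : exists n, d = (p ^ n)%N.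
  apply: contrapT => Nd; apply: (@na_oner_neq0 R); rewrite -b1 bm // => i dE.
  by apply: Nd; exists i.
right; exists b@_0, n, (fun i => b@_(p ^ i)%N).
have bE : b = C b@_0 + \sum_(i < n.+1) monom b@_(p ^ i)%N (p ^ i).
  apply: coefP => j; rewrite coefD coefC coef_sum.
  under eq_bigr => i _ do rewrite coef_monom.
  have [[i ->]|Nj] := pselect (exists i, j = (p ^ i)%N).
    rewrite -[_ == 0%N]negbK -lt0n expn_gt0 p0 mulr0n add0r.
    have [lt|ge] := ltnP i n.+1.
      rewrite (bigD1 (Ordinal lt)) //= eqxx mulr1n big1 ?addr0 // => k ki.
      rewrite eqn_exp2l ?prime_gt1 //.
      by case: eqP => // e; case/eqP: ki; apply: val_inj.
    rewrite bd; last by rewrite dE ltn_exp2l ?prime_gt1.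
    rewrite big1 // => k _; rewrite eqn_exp2l ?prime_gt1 //.
    by case: eqP => // e; move: ge; rewrite -e leqNgt ltn_ord.
  rewrite big1 ?addr0 => [|i _]; last first.
    by case: eqP => // e; case: Nj; exists i.
  case: j Nj => [|j] Nj; first by rewrite mulr1n.
  by rewrite mulr0n bm // => i e; apply: Nj; exists i.
split=> [||//|r]; first exact: kb.
  split=> [i _|]; last by rewrite -dE.
  by have [] := center_generator_hasse gb (_ : 0 < p ^ i)%N; rewrite ?expn_gt0 ?p0.
have := congr1 (fun p : D => p@_0)
  (center_comm (C r) (center_generator_center gb)).
rewrite {1}bE na_mulDl na_mul_suml coefD coef0_monomM coef_constM.
rewrite coef_sum /=.
under eq_bigr => i _ do rewrite coef0_monomM.
by rewrite /inner_der opprB => <-; rewrite addrAC subrr add0r.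
Qed.

End Kernel.
End DifferentialPolynomials.

Theorem theorem6 (R : nonAssocRingType) (delta : {additive R -> R})
    (delta1 : delta na_one = 0) (kdelta : kernel_derivation delta) :
  (* (a) *)
  (delta_simple delta ->
     forall I : set (ore delta1), ideal I -> I <> [set 0] ->
       exists! f : ore delta1,
         [/\ ore_monic f, center (ore delta1) f & I = ideal_generated f]) /\
  (* (b) *)
  (delta_simple delta ->
     (exists b : ore delta1, center_generator b) /\
     (forall b b' : ore delta1, center_generator b -> center_generator b' ->
        exists2 z : R, center_kernel delta z & b' = b + ore_const delta1 z)) /\
  (* (c) *)
  ((simple_ring (ore delta1) <->
      delta_simple delta /\ field_in (center (ore delta1))) /\
   (simple_ring (ore delta1) ->
      center (ore delta1) = ore_const delta1 @` center_kernel delta /\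
      (forall b : ore delta1, center_generator b -> b = na_one))) /\
  (* (d) *)
  (delta_simple delta -> derivation delta -> has_char R 0 ->
     forall b : ore delta1, center_generator b ->
       b = na_one \/
       exists c : R,
         [/\ kernel delta c,
             b = ore_const delta1 c + ore_monom delta1 na_one 1 &
             forall r : R, delta r = - inner_der c r]) /\
  (* (e) *)
  (forall p : nat, (0 < p)%N ->
     delta_simple delta -> derivation delta -> has_char R p ->
     forall b : ore delta1, center_generator b ->
       b = na_one \/
       exists (c : R) (n : nat) (z : nat -> R),
         [/\ kernel delta c,
             (forall i : nat, (i <= n)%N -> center_kernel delta (z i)) /\
             z n = na_one,
             b = ore_const delta1 c +
                 \sum_(i < n.+1) ore_monom delta1 (z i) (p ^ i) &
             forall r : R,
               \sum_(i < n.+1) z i ** iter (p ^ i) delta r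
                 = - inner_der c r]).
Proof.
split.
  move=> sdelta I iI I0.
  have [f [mf Zf IE]] := ideal_center_generator kdelta sdelta iI I0.
  exists f; split=> // g [mg Zg IE'].
  by apply: (ideal_monic_unique mf mg Zf Zg); rewrite -IE -IE'.
split.
  move=> sdelta; split; first exact: center_generator_exists.
  move=> b b' gb gb'; have [z Fz e] := center_generator_unique gb gb'.
  by exists z; rewrite // constE.
split.
  split.
    split=> [sD|[sdelta fZ]]; last exact: field_center_simple.
    by split; [apply: simple_delta_simple sD|apply: simple_center_field].
  move=> sD; have sdelta := simple_delta_simple sD.
  have fZ := simple_center_field sD.
  have const (b : ore delta1) : center_generator b -> deg_lt b 1.
    exact: field_center_generator.
  split=> [|b gb]; last exact: (center_generator_deg0 gb (const b gb)).
  have [b gb] := center_generator_exists delta1 kdelta sdelta.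
  apply/seteqP; split=> [f Zf|_ [a Fa <-]]; last first.
    by rewrite constE; apply: const_center.
  have f1 := center_generator1_deg_lt gb (const b gb) Zf.
  by have [a Fa ->] := center_deg_lt1 Zf f1; exists a; rewrite ?constE.
split.
  move=> sdelta _ ch0 b gb.
  have [->|[c [kc bE dE]]] := center_generator_char0 kdelta sdelta ch0 gb.
    by left.
  by right; exists c; split=> //; rewrite constE monomE.
move=> p p0 sdelta _ chp b gb.
have [->|[c [n [z [kc Fz bE dE]]]]] :=
  center_generator_charp kdelta sdelta p0 chp gb; first by left.
right; exists c, n, z; split=> //; rewrite constE bE; congr (_ + _).
by apply: eq_bigr => i _; rewrite monomE.
Qed.
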